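(* $\mathbf\Delta_\infty=\mathbf\Delta\cap(\mathcal P_{\infty,\infty}\times\mathcal P_{\infty,\infty})$ is dense in $\mathcal P_{\infty,\infty}\times\mathcal P_{\infty,\infty}$ in the operator norm topology.
   Context: $\mathcal H$ is a separable infinite-dimensional complex Hilbert space, $\mathcal B(\mathcal H)$ the bounded operators, $\mathcal P(\mathcal H)=\{P\in\mathcal B(\mathcal H):P=P^2=P^*\}$ with the norm topology. For a closed subspace $\mathcal S$, $P_{\mathcal S}$ denotes the orthogonal projection onto $\mathcal S$; closed subspaces are identified with their projections. Two closed subspaces $\mathcal S,\mathcal T$ have a common complement if there is a closed subspace $\mathcal Z$ with $\mathcal S\cap\mathcal Z=\mathcal T\cap\mathcal Z=\{0\}$ and $\mathcal S+\mathcal Z=\mathcal T+\mathcal Z=\mathcal H$. $\mathbf\Delta=\{(P_{\mathcal S},P_{\mathcal T})\in\mathcal P(\mathcal H)\times\mathcal P(\mathcal H):\mathcal S,\mathcal T\text{ have a common complement}\}$ and $\mathbf\Gamma=(\mathcal P(\mathcal H)\times\mathcal P(\mathcal H))\setminus\mathbf\Delta$. For $0\le i,j\le\infty$ with $i+j=\infty$, $\mathcal P_{i,j}$ denotes the set of projections of rank $i$ and corank ($=\dim$ of null space) $j$. *)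

(* Defs.v *)
From mathcomp Require Import all_boot all_order all_algebra.
From mathcomp Require Import all_classical all_reals all_analysis.
From mathcomp Require Import complex.
Import Order.TTheory GRing.Theory Num.Theory.
Local Open Scope ring_scope.
Local Open Scope classical_set_scope.

Set Implicit Arguments. Unset Strict Implicit. Unset Printing Implicit Defensive.

Section Hilbert.
Variables (R : realType) (H : completeNormedModType R[i]).

(* ip is an inner product (linear in the first argument, conjugate symmetric)
   inducing the norm of H; H being complete, (H, ip) is a Hilbert space. *)
Definition inner_product (ip : H -> H -> R[i]) : Prop :=
  [/\ forall (a : R[i]) (x y z : H), ip (a *: x + y) z = a * ip x z + ip y z,
      forall x y : H, ip y x = (ip x y)^*
    & forall x : H, ip x x = `|x| ^+ 2].

Definition separable_space : Prop :=
  exists u : nat -> H, closure (range u) = [set: H].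

Definition lin_indep (n : nat) (v : 'I_n -> H) : Prop :=
  forall c : 'I_n -> R[i], \sum_(i < n) c i *: v i = 0 -> forall i, c i = 0.

Definition infinite_dim (S : set H) : Prop :=
  forall n : nat, exists v : 'I_n -> H, (forall i, S (v i)) /\ lin_indep v.

Definition bounded_op (T : H -> H) : Prop :=
  (forall (a : R[i]) (x y : H), T (a *: x + y) = a *: T x + T y) /\
  exists M : R[i], forall x : H, `|T x| <= M * `|x|.

Definition orth_proj (ip : H -> H -> R[i]) (T : H -> H) : Prop :=
  [/\ bounded_op T, forall x, T (T x) = T x & forall x y, ip (T x) y = ip x (T y)].

Definition nullspace (T : H -> H) : set H := T @^-1` [set 0].

Definition proj_inf_inf (ip : H -> H -> R[i]) (T : H -> H) : Prop :=
  [/\ orth_proj ip T, infinite_dim (range T) & infinite_dim (nullspace T)].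

Definition closed_subspace (Z : set H) : Prop :=
  [/\ Z 0, (forall (a : R[i]) x y, Z x -> Z y -> Z (a *: x + y)) & closed Z].

Definition common_complement (S T : set H) : Prop :=
  exists Z : set H,
    [/\ closed_subspace Z,
        S `&` Z `<=` [set 0], T `&` Z `<=` [set 0],
        (forall h : H, exists s z, [/\ S s, Z z & h = s + z])
      & (forall h : H, exists t z, [/\ T t, Z z & h = t + z])].

Definition in_Delta (ip : H -> H -> R[i]) (P Q : H -> H) : Prop :=
  [/\ orth_proj ip P, orth_proj ip Q & common_complement (range P) (range Q)].

(* ||A|| < e for the operator norm ||A|| = inf {M | forall x, |A x| <= M |x|} *)
Definition opnorm_lt (A : H -> H) (e : R[i]) : Prop :=
  exists M : R[i], M < e /\ forall x : H, `|A x| <= M * `|x|.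

End Hilbert.

(* Main.v *)
(* Write S = ran P and T = ran Q. If a bounded operator F onto S is the identity on S
   and a bijection from T to S, then ker F is a common complement of S and T.

   Suppose T has an infinite-dimensional closed subspace T1 on which 1 - P is bounded
   below, and S one, S1, on which 1 - Q is bounded below. Take an isometry J of H into S1
   and a large constant c: then U = P + c J (1 - P) is bounded below on T. With
   T0 = {t in T : (1 - P) t is orthogonal to (1 - P) T1} one has T = T0 + T1, and U T0 has
   infinite codimension in S because U is injective on T. Keeping F = U on T0 and letting F
   map T1 isometrically onto the orthogonal complement of U T0 in S defines F on T; since
   1 - P is bounded below on T1, such an F extends boundedly to H with F = 1 on S.

   To produce T1, choose greedily an orthonormal sequence alternating between T and the
   orthogonal complement of S. This gives infinite-dimensional X in T and Y in that
   complement with X orthogonal to Y. If K is a partial isometry from X onto Y, then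
   T' = (1 + th K) T is close to T and 1 - P is bounded below on (1 + th K) X. Perturbing
   first T relative to S, then S (by much less) relative to T', gives both conditions. *)

Require Import Defs.
From mathcomp Require Import all_boot all_order all_algebra.
From mathcomp Require Import all_classical all_reals all_analysis.
From mathcomp Require Import complex.
From mathcomp Require Import ring lra.
Import Order.TTheory GRing.Theory Num.Theory.
Local Open Scope ring_scope.
Local Open Scope classical_set_scope.

Set Implicit Arguments. Unset Strict Implicit. Unset Printing Implicit Defensive.

(** * Real-valued norms, closed subspaces and bounded linear maps *)

Section NormedSpace.
Variables (R : realType) (H : completeNormedModType R[i]).
Local Notation C := R[i].
Implicit Types (x y z : H) (A B : set H) (F G : H -> H).

(** The norm of [H] takes its values in [R[i]]; its real part lies in the ordered field [R], where
    order reasoning and suprema are available. *)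
Definition rnorm x : R := complex.Re `|x|.

Lemma rnormE x : `|x| = (rnorm x)%:C%C.
Proof. by rewrite /rnorm RRe_real// ger0_real. Qed.

Lemma rnorm_ge0 x : 0 <= rnorm x.
Proof. by rewrite -ler0c -rnormE. Qed.

Lemma rnorm0 : rnorm 0 = 0.
Proof. by rewrite /rnorm normr0. Qed.

Lemma rnorm_eq0 x : rnorm x = 0 -> x = 0.
Proof. by move=> x0; apply: normr0_eq0; rewrite rnormE x0. Qed.

Lemma rnormD x y : rnorm (x + y) <= rnorm x + rnorm y.
Proof. by rewrite -lecR rmorphD /= -!rnormE ler_normD. Qed.

Lemma rnormN x : rnorm (- x) = rnorm x.
Proof. by rewrite /rnorm normrN. Qed.

Lemma rnormB x y : rnorm (x - y) <= rnorm x + rnorm y.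
Proof. by rewrite -(rnormN y) rnormD. Qed.

Lemma rnormBC x y : rnorm (x - y) = rnorm (y - x).
Proof. by rewrite -rnormN opprB. Qed.

Lemma rnormDB x y : rnorm x - rnorm y <= rnorm (x + y).
Proof. by rewrite lerBlDr -{1}(addrK y x) rnormB. Qed.

Lemma rnormZ (a : R) x : rnorm (a%:C%C *: x) = `|a| * rnorm x.
Proof.
apply: (@complexI R); rewrite rmorphM /= -!rnormE normrZ; congr (_ * _).
by rewrite normc_def /= expr0n addr0 sqrtr_sqr.
Qed.

Lemma rnormZi x : rnorm ('i%C *: x) = rnorm x.
Proof.
by rewrite /rnorm normrZ normc_def /= expr0n expr1n add0r sqrtr1 mul1r.
Qed.

Lemma inv_nat_small (e : R) :
  0 < e -> exists n, forall m, (n <= m)%N -> m.+1%:R^-1 < e.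
Proof.
move=> e0; exists (Num.truncn e^-1) => m nm.
rewrite invf_plt ?posrE//; apply: (lt_le_trans (truncnS_gt _)).
by rewrite ler_nat.
Qed.

Lemma rnorm_small x : (forall e, 0 < e -> rnorm x <= e) -> x = 0.
Proof.
move=> h; apply/rnorm_eq0/eqP; rewrite eq_le rnorm_ge0 andbT.
by apply/ler_addgt0Pl => e /h; rewrite addr0.
Qed.

Lemma gt0_complex (e : C) : 0 < e -> exists2 e' : R, 0 < e' & e = e'%:C%C.
Proof.
move=> e0; exists (complex.Re e); last by rewrite RRe_real// gtr0_real.
by rewrite -ltcR RRe_real// gtr0_real.
Qed.

Lemma closure_rnormP A x :
  closure A x <-> forall e : R, 0 < e -> exists2 a, A a & rnorm (a - x) < e.
Proof.
split=> [Ax e e0|hx B /nbhs_ballP[_ /= /gt0_complex[e e0 ->] xB]].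
  have /Ax[a [Aa]] : nbhs x (ball x e%:C%C) by apply: nbhsx_ballx; rewrite ltcR.
  by rewrite -ball_normE /ball_ /= rnormE ltcR rnormBC => xa; exists a.
have [a Aa xa] := hx e e0; exists a; split => //; apply: xB.
by rewrite -ball_normE /ball_ /= rnormE ltcR rnormBC.
Qed.

Lemma closed_rnormP A :
  closed A <->
  forall x, (forall e : R, 0 < e -> exists2 a, A a & rnorm (a - x) < e) -> A x.
Proof.
by split=> hA x => [/closure_rnormP/hA|/closure_rnormP/hA].
Qed.

Lemma cauchy_rnorm_cvg (u : nat -> H) :
  (forall e : R, 0 < e ->
     exists n, forall m k, (n <= m)%N -> (n <= k)%N -> rnorm (u m - u k) < e) ->
  exists l, forall e : R, 0 < e ->
     exists n, forall m, (n <= m)%N -> rnorm (u m - l) < e.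
Proof.
move=> hu.
have : cauchy (u @ \oo).
  apply/cauchy_ballP => _ /gt0_complex[e e0 ->]; near_simpl.
  have [n hn] := hu e e0.
  exists ([set k | (n <= k)%N], [set k | (n <= k)%N]); first by split; exists n.
  move=> [m k] /= [nm nk]; rewrite -ball_normE /ball_ /= rnormE ltcR.
  exact: hn.
move/cauchy_cvg/cvg_ex => [l ul]; exists l => e e0.
move/cvgrPdist_lt: ul => /(_ e%:C%C); rewrite ltcR => /(_ e0) [n _ hn].
by exists n => m nm; have := hn m nm; rewrite /= rnormE ltcR rnormBC.
Qed.
Lemma linear0 F : linear F -> F 0 = 0.
Proof. by move=> lF; have := lF (-1) 0 0; rewrite scaler0 addr0 scaleN1r addNr. Qed.

Lemma linearZ_fun F a x : linear F -> F (a *: x) = a *: F x.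
Proof. by move=> lF; have := lF a x 0; rewrite !addr0 (linear0 lF) addr0. Qed.

Lemma linearD_fun F x y : linear F -> F (x + y) = F x + F y.
Proof. by move=> lF; have := lF 1 x y; rewrite !scale1r. Qed.

Lemma linearB_fun F x y : linear F -> F (x - y) = F x - F y.
Proof. by move=> lF; rewrite linearD_fun// -scaleN1r linearZ_fun// scaleN1r. Qed.

Lemma linear_sum_fun F n (c : 'I_n -> C) (v : 'I_n -> H) : linear F ->
  F (\sum_(i < n) c i *: v i) = \sum_(i < n) c i *: F (v i).
Proof.
move=> lF; elim/big_rec2: _ => [|i y1 y2 _ <-]; first exact: linear0.
by rewrite linearD_fun// linearZ_fun.
Qed.

(** Asking for a nonnegative bound lets bounds be added and multiplied without side conditions. *)
Definition rbounded F := exists2 M : R, 0 <= M & forall x, rnorm (F x) <= M * rnorm x.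

Lemma closed_subspaceD A x y : closed_subspace A -> A x -> A y -> A (x + y).
Proof. by case=> _ hA _ Ax Ay; have := hA 1 _ _ Ax Ay; rewrite scale1r. Qed.

Lemma closed_subspaceZ A a x : closed_subspace A -> A x -> A (a *: x).
Proof. by case=> A0 hA _ Ax; have := hA a _ _ Ax A0; rewrite addr0. Qed.

Lemma closed_subspaceB A x y : closed_subspace A -> A x -> A y -> A (x - y).
Proof.
by move=> hA Ax Ay; rewrite -scaleN1r; apply: closed_subspaceD => //; exact: closed_subspaceZ.
Qed.

Lemma closed_subspaceT : closed_subspace [set: H].
Proof. by split=> //; exact: closedT. Qed.

Lemma closed_subspaceI A B :
  closed_subspace A -> closed_subspace B -> closed_subspace (A `&` B).
Proof.
move=> [A0 hA cA] [B0 hB cB]; split=> //; last exact: closedI.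
by move=> a x y [Ax Bx] [Ay By]; split; [exact: hA|exact: hB].
Qed.

Lemma closed_subspace_ker F :
  linear F -> rbounded F -> closed_subspace [set x | F x = 0].
Proof.
move=> lF [M M0 hM]; split; first exact: linear0.
  by move=> a x y /= Fx Fy; rewrite lF Fx Fy scaler0 addr0.
apply/closed_rnormP => x hx /=; apply: rnorm_small => e e0.
have M1 : 0 < M + 1 by rewrite ltr_wpDl.
have [a /= Fa ax] := hx (e / (M + 1)) (divr_gt0 e0 M1).
have -> : F x = F (x - a) by rewrite linearB_fun// Fa subr0.
apply: (le_trans (hM _)); rewrite rnormBC.
apply: (@le_trans _ _ ((M + 1) * (e / (M + 1)))); last by rewrite mulrC divfK// gt_eqF.
by apply: ler_pM => //; [exact: rnorm_ge0|rewrite lerDl|exact: ltW].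
Qed.

(** If [F (u n)] converges, the lower bound on [A] makes [u] Cauchy; by completeness it has a limit
    in [A], and continuity of [F] identifies the image of that limit. *)
Lemma closed_subspace_image A F (k : R) : closed_subspace A -> linear F ->
  rbounded F -> 0 < k -> (forall x, A x -> k * rnorm x <= rnorm (F x)) ->
  closed_subspace (F @` A).
Proof.
move=> hA lF [M M0 hM] k0 hk; have [A0 _ cA] := hA; split.
- by exists 0 => //; exact: linear0.
- move=> a _ _ [x Ax <-] [y Ay <-]; exists (a *: x + y); last exact: lF.
  by apply: closed_subspaceD => //; exact: closed_subspaceZ.
apply/closed_rnormP => z hz.
have /choice[u hu] : forall n : nat, exists x, A x /\ rnorm (F x - z) < n.+1%:R^-1.
  by move=> n; have [|_ [x Ax <-] xz] := hz n.+1%:R^-1; [rewrite invr_gt0|exists x].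
have [e e0|l ul] := cauchy_rnorm_cvg (u := u).
  have [n hn] := @inv_nat_small (k * e / 2) (divr_gt0 (mulr_gt0 k0 e0) (ltr0Sn R 1)).
  exists n => m p nm np; rewrite -(ltr_pM2l k0).
  apply: (le_lt_trans (hk _ (closed_subspaceB hA (hu m).1 (hu p).1))).
  rewrite linearB_fun//.
  have -> : F (u m) - F (u p) = (F (u m) - z) - (F (u p) - z) by rewrite opprB addrA subrK.
  apply: (le_lt_trans (rnormB _ _)).
  have := lt_trans (hu m).2 (hn _ nm); have := lt_trans (hu p).2 (hn _ np); lra.
have Al : A l.
  move/closed_rnormP: cA; apply => e /ul[n hn]; exists (u n); first exact: (hu n).1.
  exact: hn.
exists l => //; apply/eqP; rewrite -subr_eq0; apply/eqP/rnorm_small => e e0.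
have M1 : 0 < M + 1 by rewrite ltr_wpDl.
have [n1 h1] := ul (e / 2 / (M + 1)) (divr_gt0 (divr_gt0 e0 (ltr0Sn R 1)) M1).
have [n2 h2] := @inv_nat_small (e / 2) (divr_gt0 e0 (ltr0Sn R 1)).
pose n := maxn n1 n2.
have := h1 n (leq_maxl _ _); have := lt_trans (hu n).2 (h2 n (leq_maxr _ _)) => {h1 h2} h2 h1.
have -> : F l - z = (F (u n) - z) - F (u n - l).
  by rewrite linearB_fun// opprB addrCA addrAC subrr add0r.
apply: (le_trans (rnormB _ _)).
have h3 : M * rnorm (u n - l) <= e / 2.
  apply: (@le_trans _ _ ((M + 1) * (e / 2 / (M + 1)))); last by rewrite mulrC divfK// gt_eqF.
  by apply: ler_pM => //; [exact: rnorm_ge0|rewrite lerDl|exact: ltW].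
have := hM (u n - l); lra.
Qed.

Lemma infinite_dim_image A B F : closed_subspace A -> linear F ->
  (forall x, A x -> B (F x)) -> (forall x, A x -> F x = 0 -> x = 0) ->
  infinite_dim A -> infinite_dim B.
Proof.
move=> hA lF AB inj iA n; have [v [Av vI]] := iA n.
exists (F \o v); split=> [i|c hc]; first exact: AB.
apply: vI; apply: inj; last by rewrite linear_sum_fun.
elim/big_ind: _ => //; first by case: hA.
  by move=> x y; exact: closed_subspaceD.
by move=> i _; exact: closed_subspaceZ.
Qed.

End NormedSpace.

(** * Inner products, nearest points and orthogonal projections *)

Section InnerProduct.
Variables (R : realType) (H : completeNormedModType R[i]) (ip : H -> H -> R[i]).
Hypothesis hip : inner_product ip.
Local Notation C := R[i].
Implicit Types (x y z : H) (A B : set H) (E F : H -> H).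

Lemma ipDl x y z : ip (x + y) z = ip x z + ip y z.
Proof. by case: hip => h _ _; have := h 1 x y z; rewrite scale1r mul1r. Qed.

Lemma ip0l z : ip 0 z = 0.
Proof. by have := ipDl 0 0 z; rewrite addr0 => /eqP; rewrite -subr_eq subrr eq_sym => /eqP. Qed.

Lemma ipZl a x z : ip (a *: x) z = a * ip x z.
Proof. by case: hip => h _ _; have := h a x 0 z; rewrite !addr0 ip0l addr0. Qed.

Lemma ipBl x y z : ip (x - y) z = ip x z - ip y z.
Proof. by rewrite ipDl -scaleN1r ipZl mulN1r. Qed.

Lemma ipC x y : ip y x = (ip x y)^*.
Proof. by case: hip. Qed.

Lemma ipZr a x z : ip x (a *: z) = a^* * ip x z.
Proof. by rewrite (ipC (a *: z)) ipZl rmorphM (ipC z x). Qed.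

Lemma ipBr x y z : ip x (y - z) = ip x y - ip x z.
Proof. by rewrite (ipC (y - z)) ipBl rmorphB (ipC y x) (ipC z x). Qed.

Lemma ip0r x : ip x 0 = 0.
Proof. by rewrite ipC ip0l rmorph0. Qed.

Lemma ip_eq0C x y : ip x y = 0 -> ip y x = 0.
Proof. by move=> xy; rewrite ipC xy rmorph0. Qed.

Definition rip x y : R := complex.Re (ip x y).

Lemma ReD (a b : C) : complex.Re (a + b) = complex.Re a + complex.Re b.
Proof. by case: a b => [? ?] [? ?]. Qed.

Lemma ReN (a : C) : complex.Re (- a) = - complex.Re a.
Proof. by case: a. Qed.

Lemma ripC x y : rip x y = rip y x.
Proof. by rewrite /rip (ipC y x); case: (ip y x). Qed.

Lemma ripDl x y z : rip (x + y) z = rip x z + rip y z.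
Proof. by rewrite /rip ipDl ReD. Qed.

Lemma ripNl x z : rip (- x) z = - rip x z.
Proof. by rewrite /rip -scaleN1r ipZl mulN1r ReN. Qed.

Lemma ripZl (a : R) x z : rip (a%:C%C *: x) z = a * rip x z.
Proof. by rewrite /rip ipZl; case: (ip x z) => u v /=; rewrite mul0r subr0. Qed.

Lemma ripZil x z : rip ('i%C *: x) z = - complex.Im (ip x z).
Proof. by rewrite /rip ipZl mulrC ReiNIm. Qed.

Lemma rnorm_sq x : rnorm x ^+ 2 = rip x x.
Proof. by case: hip => _ _ h; rewrite /rip h rnormE -rmorphXn. Qed.

Lemma ip_self x : ip x x = (rnorm x ^+ 2)%:C%C.
Proof. by case: hip => _ _ h; rewrite h rnormE -rmorphXn. Qed.

Lemma rnormD_sq x y : rnorm (x + y) ^+ 2 = rnorm x ^+ 2 + rnorm y ^+ 2 + 2 * rip x y.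
Proof. by rewrite !rnorm_sq ripDl (ripC x (x + y)) (ripC y (x + y)) !ripDl (ripC y x); ring. Qed.

Lemma rnormB_sq x y : rnorm (x - y) ^+ 2 = rnorm x ^+ 2 + rnorm y ^+ 2 - 2 * rip x y.
Proof. by rewrite rnormD_sq rnormN ripC ripNl (ripC y x); ring. Qed.

Lemma rnormD_orth x y : ip x y = 0 -> rnorm (x + y) ^+ 2 = rnorm x ^+ 2 + rnorm y ^+ 2.
Proof. by move=> xy; rewrite rnormD_sq /rip xy mulr0 addr0. Qed.

Lemma rip_le x y : rip x y <= rnorm x * rnorm y.
Proof.
have := rnormD_sq x y; have := rnormD x y; have := rnorm_ge0 (x + y).
have := rnorm_ge0 x; have := rnorm_ge0 y; nra.
Qed.

Lemma rip_abs x y : `|rip x y| <= rnorm x * rnorm y.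
Proof. by rewrite ler_norml rip_le andbT lerNl -ripNl -(rnormN x) rip_le. Qed.

(** Continuity of the inner product at 0, in the form in which limits are taken below: if one value
    is attained on arbitrarily short vectors, Cauchy-Schwarz forces it to be 0. The real and
    imaginary parts are treated separately. *)
Lemma ip_small_eq0 z (c : C) :
  (forall e : R, 0 < e -> exists2 u, rnorm u < e & ip u z = c) -> c = 0.
Proof.
move=> h.
have hsmall (r : R) : (forall e, 0 < e -> `|r| <= e * rnorm z) -> r = 0.
  move=> hr; apply/eqP; rewrite -normr_eq0 eq_le normr_ge0 andbT.
  apply/ler_addgt0Pl => e e0; rewrite addr0.
  have z1 : 0 < rnorm z + 1 by rewrite ltr_wpDl// rnorm_ge0.
  apply: (le_trans (hr (e / (rnorm z + 1)) (divr_gt0 e0 z1))).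
  by rewrite mulrAC ler_pdivrMr// ler_pM2l// lerDl.
have hRe : complex.Re c = 0.
  apply: hsmall => e /h[u ue <-]; apply: (le_trans (rip_abs u z)).
  by rewrite ler_wpM2r ?rnorm_ge0// ltW.
have hIm : complex.Im c = 0.
  apply: hsmall => e /h[u ue <-].
  rewrite -normrN -ripZil; apply: (le_trans (rip_abs _ z)).
  by rewrite rnormZi ler_wpM2r ?rnorm_ge0// ltW.
by apply/eqP; rewrite eq_complex hRe hIm !eqxx.
Qed.

Definition orthc A : set H := [set x | forall a, A a -> ip x a = 0].

Lemma closed_subspace_orthc A : closed_subspace (orthc A).
Proof.
split=> [a _|a x y hx hy b Ab|]; first exact: ip0l.
  by rewrite ipDl ipZl hx// hy// mulr0 addr0.
apply/closed_rnormP => x hx a Aa; apply: (@ip_small_eq0 a) => e e0.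
have [b hb bx] := hx e e0; exists (x - b); first by rewrite rnormBC.
by rewrite ipBl hb// subr0.
Qed.

(** Unlike [orth_proj], this names the subspace; boundedness, idempotence and symmetry follow from
    it. *)
Definition proj_onto E A :=
  [/\ linear E, forall x, A (E x) & forall x a, A a -> ip (x - E x) a = 0].

(** First-order condition at a minimum: moving from [a] along a real multiple of [b] cannot decrease
    the distance, so the real part of the inner product vanishes. Applying this to ['i *: b] handles
    the imaginary part. *)
Lemma minimizer_orth A x a : closed_subspace A -> A a ->
  (forall b, A b -> rnorm (x - a) <= rnorm (x - b)) -> forall b, A b -> ip (x - a) b = 0.
Proof.
move=> hA Aa hmin.
have hRe b : A b -> rip (x - a) b = 0.
  move=> Ab.
  have hn (t : R) : rnorm (x - a) ^+ 2 <= rnorm (x - a - t%:C%C *: b) ^+ 2.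
    rewrite ler_pXn2r ?nnegrE ?rnorm_ge0// -addrA -opprD hmin//.
    by apply: closed_subspaceD => //; exact: closed_subspaceZ.
  have [/rnorm_eq0 ->|b0] := eqVneq (rnorm b) 0; first by rewrite /rip ip0r.
  have {}b0 : 0 < rnorm b ^+ 2 by rewrite exprn_gt0// lt_def b0 rnorm_ge0.
  (* The quadratic t -> |x - a - t b|^2 is smallest at t = [q]. *)
  pose r := rip (x - a) b; pose q := r / rnorm b ^+ 2.
  have := hn q.
  rewrite (rnormB_sq (x - a)) rnormZ exprMn real_normK ?num_real//.
  rewrite (ripC (x - a)) ripZl (ripC b) -/r => h.
  have qE : r = q * rnorm b ^+ 2 by rewrite /q divfK// gt_eqF.
  have /eqP : q ^+ 2 * rnorm b ^+ 2 = 0.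
    apply/eqP; rewrite eq_le mulr_ge0 ?sqr_ge0// andbT.
    by move: h; rewrite qE; nra.
  by rewrite mulf_eq0 (gt_eqF b0) orbF sqrf_eq0 => /eqP q0; rewrite -/r qE q0 mul0r.
move=> b Ab; apply/eqP; rewrite eq_complex; apply/andP; split; apply/eqP.
  exact: hRe.
have := hRe _ (closed_subspaceZ 'i%C hA Ab); rewrite ripC ripZil ipC.
by case: (ip (x - a) b) => u v /=; rewrite opprK.
Qed.

(** A minimizing sequence is Cauchy by the parallelogram law, and [A] is complete. *)
Lemma minimizer_exists A x : closed_subspace A ->
  exists2 a, A a & forall b, A b -> rnorm (x - a) <= rnorm (x - b).
Proof.
move=> hA; have [A0 _ /closed_rnormP cA] := hA.
pose D := [set rnorm (x - a) | a in A]; pose d := inf D.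
have infD : has_inf D.
  by split; [exists (rnorm (x - 0)); exists 0|exists 0 => _ [a _ <-]; exact: rnorm_ge0].
have dle b : A b -> d <= rnorm (x - b).
  by move=> Ab; apply: ge_inf; [exact: infD.2|exists b].
have d0 : 0 <= d by apply: lb_le_inf; [exact: infD.1|move=> _ [a _ <-]; exact: rnorm_ge0].
have /choice[u hu] : forall n : nat, exists a, A a /\ rnorm (x - a) < d + n.+1%:R^-1.
  move=> n; have [|_ [a Aa <-] h] := @inf_adherent _ D n.+1%:R^-1 _ infD.
    by rewrite invr_gt0.
  by exists a.
(* The midpoint of [a] and [b] lies in [A], hence at distance at least [d] from [x]; the
   parallelogram law then gives |a - b|^2 <= 4 (d + t)^2 - 4 d^2. *)
have near_min a b (t : R) : A a -> A b -> 0 <= t -> rnorm (x - a) <= d + t ->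
    rnorm (x - b) <= d + t -> rnorm (a - b) ^+ 2 <= 8 * d * t + 4 * t ^+ 2.
  move=> Aa Ab t0 xa xb.
  have h1 := rnormD_sq (x - a) (x - b); have h2 := rnormB_sq (x - a) (x - b).
  have ab : x - a - (x - b) = b - a by rewrite opprB addrC addrA subrK.
  rewrite {}ab rnormBC in h2.
  have mid : x - a + (x - b) = (2 : R)%:C%C *: (x - (2^-1 : R)%:C%C *: (a + b)).
    rewrite scalerBr scalerA -rmorphM /= divff ?pnatr_eq0// scale1r.
    by rewrite rmorphD /= scalerDl !scale1r opprD addrACA.
  have Am : A ((2^-1 : R)%:C%C *: (a + b)).
    by apply: closed_subspaceZ => //; exact: closed_subspaceD.
  have dm := dle _ Am.
  rewrite {}mid rnormZ (@ger0_norm _ 2)// exprMn in h1.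
  have sq_le (c c' : R) : 0 <= c -> c <= c' -> c ^+ 2 <= c' ^+ 2.
    by move=> c0 cc'; rewrite ler_pXn2r ?nnegrE// (le_trans c0).
  have := sq_le _ _ (rnorm_ge0 _) xa; have := sq_le _ _ (rnorm_ge0 _) xb.
  have := sq_le _ _ d0 dm; lra.
have [e e0|l ul] := cauchy_rnorm_cvg (u := u).
  have D1 : 0 < 8 * d + 4 by lra.
  (* Since t <= 1, the bound 8 d t + 4 t^2 is at most (8 d + 4) t, hence at most e^2 / 2. *)
  pose t := Num.min 1 (e ^+ 2 / 2 / (8 * d + 4)).
  have t0 : 0 < t by rewrite lt_min ltr01 /= divr_gt0// divr_gt0// exprn_gt0.
  have [n hn] := @inv_nat_small _ t t0.
  exists n => m p nm np.
  have := @near_min (u m) (u p) t (hu m).1 (hu p).1 (ltW t0).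
  have hm k : (n <= k)%N -> rnorm (x - u k) <= d + t.
    by move=> nk; apply: ltW (lt_trans (hu k).2 _); rewrite ltrD2l hn.
  move=> /(_ (hm _ nm) (hm _ np)) h.
  rewrite -(@ltr_pXn2r _ 2) ?nnegrE ?rnorm_ge0 ?ltW//; apply: (le_lt_trans h).
  have t1 : t <= 1 by rewrite ge_min lexx.
  have t2 : (8 * d + 4) * t <= e ^+ 2 / 2.
    by rewrite mulrC -ler_pdivlMr// ge_min lexx orbT.
  have : 0 < e ^+ 2 by rewrite exprn_gt0.
  nra.
have Al : A l.
  by apply: cA => e /ul[n hn]; exists (u n); [exact: (hu n).1|exact: hn].
exists l => // b Ab; apply: (@le_trans _ _ d); last exact: dle.
apply/ler_addgt0Pr => e e0.
have [n1 h1] := ul (e / 2) (divr_gt0 e0 (ltr0Sn R 1)).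
have [n2 h2] := @inv_nat_small _ (e / 2) (divr_gt0 e0 (ltr0Sn R 1)).
pose n := maxn n1 n2.
have := h1 n (leq_maxl _ _).
have : rnorm (x - u n) < d + e / 2.
  by apply: (lt_trans (hu n).2); rewrite ltrD2l h2// leq_maxr.
have -> : x - l = (x - u n) + (u n - l) by rewrite addrA subrK.
have := rnormD (x - u n) (u n - l); lra.
Qed.

Lemma orth_decomp_unique A x a b : closed_subspace A -> A a -> A b ->
  (forall c, A c -> ip (x - a) c = 0) -> (forall c, A c -> ip (x - b) c = 0) -> a = b.
Proof.
move=> hA Aa Ab ha hb; apply/eqP; rewrite -subr_eq0; apply/eqP/rnorm_eq0/eqP.
have Aab := closed_subspaceB hA Aa Ab.
rewrite -sqrf_eq0 rnorm_sq /rip.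
have -> : a - b = (x - b) - (x - a) by rewrite opprB [RHS]addrC addrA subrK.
rewrite ipBl; have -> : x - b - (x - a) = a - b by rewrite opprB addrC addrA subrK.
by rewrite ha// hb// subrr.
Qed.

Lemma proj_exists A : closed_subspace A -> exists E, proj_onto E A.
Proof.
move=> hA.
have /choice[E hE] : forall x, exists a, A a /\ forall b, A b -> ip (x - a) b = 0.
  move=> x; have [a Aa ha] := minimizer_exists x hA.
  by exists a; split => //; exact: minimizer_orth.
exists E; split=> [a x y|x|x b Ab]; [|exact: (hE x).1|exact: (hE x).2].
apply: (orth_decomp_unique (x := a *: x + y) hA); first exact: (hE _).1.
- by case: hA => _ h _; apply: h; exact: (hE _).1.
- exact: (hE _).2.
move=> c Ac; rewrite opprD addrACA -scalerBr ipDl ipZl.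
by rewrite (hE x).2// (hE y).2// mulr0 addr0.
Qed.

Section Projection.
Variables (A : set H) (E : H -> H).
Hypotheses (hA : closed_subspace A) (hE : proj_onto E A).

Lemma proj_id a : A a -> E a = a.
Proof.
move=> Aa; have [_ AE oE] := hE.
apply: (orth_decomp_unique (x := a) hA) => //; first exact: oE.
by move=> c _; rewrite subrr ip0l.
Qed.

Lemma proj_orth0 x : orthc A x -> E x = 0.
Proof.
move=> Ax; have [_ AE oE] := hE; have [A0 _ _] := hA.
apply: (orth_decomp_unique (x := x) hA) => //; first exact: oE.
by move=> c Ac; rewrite subr0 Ax.
Qed.

Lemma proj_eq0 x : E x = 0 -> orthc A x.
Proof. by move=> Ex a Aa; have [_ _ /(_ x a Aa)] := hE; rewrite Ex subr0. Qed.

Lemma proj_orthc x : orthc A (x - E x).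
Proof. by case: hE => _ _ h a; exact: h. Qed.

Lemma proj_ip x a : A a -> ip (E x) a = ip x a.
Proof.
by case: hE => _ _ h Aa; apply/eqP; rewrite -subr_eq0 -opprB -ipBl h// oppr0.
Qed.

Lemma proj_sym x y : ip (E x) y = ip x (E y).
Proof.
have [_ AE _] := hE.
by rewrite -(proj_ip x (AE y)) ipC -(proj_ip y (AE x)) -ipC.
Qed.

Lemma proj_pythag x : rnorm x ^+ 2 = rnorm (E x) ^+ 2 + rnorm (x - E x) ^+ 2.
Proof.
rewrite -rnormD_orth; first by rewrite addrC subrK.
by apply/ip_eq0C; have [_ AE h] := hE; exact: h.
Qed.

Lemma proj_le x : rnorm (E x) <= rnorm x.
Proof.
rewrite -(@ler_pXn2r _ 2) ?nnegrE ?rnorm_ge0// (proj_pythag x).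
by rewrite lerDl sqr_ge0.
Qed.

Lemma proj_compl_le x : rnorm (x - E x) <= rnorm x.
Proof.
rewrite -(@ler_pXn2r _ 2) ?nnegrE ?rnorm_ge0// (proj_pythag x).
by rewrite lerDr sqr_ge0.
Qed.

Lemma proj_compl_linear : linear (fun x => x - E x).
Proof.
by case: hE => lE _ _ a x y; rewrite lE scalerBr opprD addrACA.
Qed.

Lemma proj_dist x a : A a -> rnorm (x - E x) <= rnorm (x - a).
Proof.
move=> Aa; have [lE _ _] := hE.
by have := proj_compl_le (x - a); rewrite linearB_fun// (proj_id Aa) opprB addrA subrK.
Qed.

Lemma proj_onto_orth_proj : orth_proj ip E.
Proof.
have [lE AE _] := hE; split; last exact: proj_sym.
- by split=> //; exists 1 => x; rewrite mul1r !rnormE lecR; exact: proj_le.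
- by move=> x; exact: proj_id.
Qed.

Lemma proj_range : range E = A.
Proof.
apply/seteqP; split=> [_ [x _ <-]|a Aa]; first by case: hE.
by exists a => //; exact: proj_id.
Qed.

Lemma proj_nullspace : nullspace E = orthc A.
Proof. by apply/seteqP; split=> x; [exact: proj_eq0|exact: proj_orth0]. Qed.

End Projection.

(** The range is closed because it equals its double orthogonal complement. *)
Lemma orth_proj_onto P : orth_proj ip P ->
  closed_subspace (range P) /\ proj_onto P (range P).
Proof.
move=> [[lP _] PP sP].
have oP x a : range P a -> ip (x - P x) a = 0.
  by move=> [y _ <-]; rewrite -sP linearB_fun// PP subrr ip0l.
have hP : proj_onto P (range P) by split=> // x; exists x.
split=> //; split; first by exists 0 => //; exact: linear0.
  by move=> a _ _ [x _ <-] [y _ <-]; exists (a *: x + y).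
have -> : range P = orthc (orthc (range P)); last by case: (closed_subspace_orthc (orthc (range P))).
apply/seteqP; split=> [x Px y hy|x hx]; first by apply: ip_eq0C; exact: hy.
exists x => //; apply/esym/eqP; rewrite -subr_eq0; apply/eqP/rnorm_eq0/eqP.
rewrite -sqrf_eq0 rnorm_sq /rip ipBl hx ?sub0r; last by move=> a; exact: oP.
by rewrite (ip_eq0C (oP x (P x) _)) ?oppr0//; exists x.
Qed.

End InnerProduct.

(** * Orthonormal sequences, bases and isometries between subspaces *)

Lemma dependent_seq (T : Type) (P : seq T -> T -> Prop) :
  (forall l, exists x, P l x) -> exists u : nat -> T, forall n, P (mkseq u n) (u n).
Proof.
(* [L n] lists the first n terms, so each new term may depend on all the earlier ones. *)
move=> /choice[g hg]; pose L := fix L n := if n is m.+1 then rcons (L m) (g (L m)) else [::].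
exists (g \o L) => n; have -> : mkseq (g \o L) n = L n by elim: n => // n IH; rewrite mkseqS IH.
exact: hg.
Qed.

Section Orthonormal.
Variables (R : realType) (H : completeNormedModType R[i]) (ip : H -> H -> R[i]).
Hypothesis hip : inner_product ip.
Local Notation C := R[i].
Implicit Types (x y z : H) (A B : set H) (e f : nat -> H).

Definition orthonormal e := forall n m, ip (e n) (e m) = (n == m)%:R.

Lemma orthonormal_dependent_seq (P : seq H -> H -> Prop) :
  (forall l, exists x, [/\ P l x, rnorm x = 1 & forall y, y \in l -> ip x y = 0]) ->
  exists2 e, orthonormal e & forall n, P (mkseq e n) (e n).
Proof.
move=> /dependent_seq[e he]; exists e => [|n]; last by case: (he n).
have lt0 n m : (m < n)%N -> ip (e n) (e m) = 0.
  by move=> mn; case: (he n) => _ _; apply; apply/mapP; exists m => //; rewrite mem_iota.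
move=> n m; case: ltngtP => [nm|mn|->].
- by apply: (ip_eq0C hip); exact: lt0.
- exact: lt0.
- by rewrite (ip_self hip); case: (he m) => _ -> _; rewrite expr1n.
Qed.

Lemma rnorm_unit x : x != 0 -> rnorm ((rnorm x)^-1%:C%C *: x) = 1.
Proof.
move=> x0; have x1 : rnorm x != 0 by apply: contra_neq x0 => /rnorm_eq0.
by rewrite rnormZ ger0_norm ?invr_ge0 ?rnorm_ge0// mulVf.
Qed.

(** Orthogonality to [l] imposes [size l] linear conditions on the combinations of one more
    independent vectors of [A]: the matrix of inner products has more rows than columns, hence a
    nonzero left kernel. *)
Lemma infinite_dim_orth_unit A (l : seq H) : closed_subspace A -> infinite_dim A ->
  exists x, [/\ A x, rnorm x = 1 & forall y, y \in l -> ip x y = 0].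
Proof.
move=> hA iA; have [v [Av vI]] := iA (size l).+1.
pose M : 'M[C]_((size l).+1, size l) := \matrix_(i, j) ip (v i) (nth 0 l j).
have : kermx M != 0.
  rewrite kermx_eq0 /row_free; apply/negP => /eqP rM.
  by have := rank_leq_col M; rewrite rM ltnn.
case/rowV0Pn => c /sub_kermxP cM c0.
pose x := \sum_(i < (size l).+1) c 0 i *: v i.
have Ax : A x.
  apply: (big_ind A) => [|y z|i _]; first by case: hA.
    exact: closed_subspaceD.
  by apply: closed_subspaceZ.
have x0 : x != 0.
  apply: contra_neq c0 => x0; apply/rowP => i; rewrite mxE.
  exact: (vI (fun i => c 0 i)).
exists ((rnorm x)^-1%:C%C *: x); split; [exact: closed_subspaceZ|exact: rnorm_unit|].
move=> _ /(nthP 0)[j jl <-]; rewrite (ipZl hip); apply/eqP; rewrite mulf_eq0.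
apply/orP; right; apply/eqP.
have := congr1 (fun N : 'rV[C]_(size l) => N 0 (Ordinal jl)) cM; rewrite !mxE => <-.
rewrite /x; elim/big_rec2: _ => [|i y1 y2 _ <-]; first exact: (ip0l hip).
by rewrite (ipDl hip) (ipZl hip) !mxE.
Qed.

Lemma orthonormal_infinite_dim A e : orthonormal e -> (forall n, A (e n)) -> infinite_dim A.
Proof.
move=> oe Ae n; exists (fun i => e i); split=> // c hc i.
have := ip0l hip (e i); rewrite -hc.
have -> : ip (\sum_(j < n) c j *: e j) (e i) = \sum_(j < n) c j * ip (e j) (e i).
  elim/big_rec2: _ => [|j y1 y2 _ <-]; first exact: (ip0l hip).
  by rewrite (ipDl hip) (ipZl hip).
rewrite (bigD1 i)//= oe eqxx mulr1 big1 ?addr0// => j ji.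
by rewrite oe (inj_eq val_inj) (negbTE ji) mulr0.
Qed.

(** Gram-Schmidt applied to the components in [A] of a dense sequence [u]. A vector of [A]
    orthogonal to every [e n] is orthogonal to every [u n], hence to itself. *)
Lemma orthonormal_basis A : separable_space H -> closed_subspace A -> infinite_dim A ->
  exists e, [/\ orthonormal e, forall n, A (e n) &
                forall z, A z -> (forall n, ip z (e n) = 0) -> z = 0].
Proof.
move=> [u hu] hA iA.
(* The length of [l] serves as the index of the term of [u] that the next vector [x] has to account
   for. *)
pose P (l : seq H) x := A x /\ forall z, A z -> (forall y, y \in l -> ip z y = 0) ->
   ip z x = 0 -> ip z (u (size l)) = 0.
have [l|e oe he] := @orthonormal_dependent_seq P.
  pose Al := A `&` orthc ip [set y | y \in l].
  have hAl : closed_subspace Al by exact: closed_subspaceI hA (closed_subspace_orthc hip _).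
  have [E hE] := proj_exists hip hAl; pose w := E (u (size l)).
  have uw z : A z -> (forall y, y \in l -> ip z y = 0) -> ip z (u (size l)) = ip z w.
    by move=> Az zl; rewrite (ipC hip) -(proj_ip hip hE) -?(ipC hip).
  (* If [u (size l)] has no component in [A] orthogonal to [l], any new unit vector will do and
     keeps the sequence infinite; otherwise that component is normalized. *)
  have [w0|w0] := eqVneq w 0.
    have [x [Ax x1 xl]] := infinite_dim_orth_unit l hA iA; exists x; split => //.
    by split=> // z Az zl _; rewrite uw// w0 (ip0r hip).
  have [_ /(_ (u (size l)))[Aw lw] _] := hE.
  exists ((rnorm w)^-1%:C%C *: w); split; last 2 first.
  - exact: rnorm_unit.
  - by move=> y yl; rewrite (ipZl hip) lw// mulr0.
  split; first exact: closed_subspaceZ.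
  move=> z Az zl; rewrite (ipZr hip) => /eqP; rewrite mulf_eq0 => /orP[|/eqP].
    rewrite conjC_eq0 -(rmorph0 (real_complex R)) => /eqP/complexI/eqP.
    by rewrite invr_eq0 => /eqP/rnorm_eq0 w1; rewrite w1 eqxx in w0.
  by move=> zw; rewrite uw.
exists e; split=> // [n|z Az ze]; first exact: (he n).1.
have zu n : ip z (u n) = 0.
  have := (he n).2 z Az; rewrite size_mkseq; apply; last exact: ze.
  by move=> _ /mapP[k _ ->].
apply/rnorm_eq0/eqP; rewrite -sqrf_eq0 -(inj_eq (@complexI R)) -(ip_self hip).
apply/eqP/(@ip_small_eq0 _ _ _ hip z) => d d0.
have /closure_rnormP/(_ d d0)[_ [n _ <-] un] : closure (range u) z by rewrite hu.
exists (z - u n); first by rewrite rnormBC.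
by rewrite (ipBl hip) (ip_eq0C hip (zu n)) subr0.
Qed.

Section Transfer.
Variables e f : nat -> H.
Hypotheses (oe : orthonormal e) (of_ : orthonormal f).

(** Partial sums of the series defining the map that sends each [e k] to [f k]; [csum] is the
    matching sum of squared coefficients. *)
Let psum x m := \sum_(0 <= k < m) ip x (e k) *: f k.
Let csum x m : R := \sum_(0 <= k < m) complex.Re (`|ip x (e k)| ^+ 2).

Lemma psum_ip x m k : ip (psum x m) (f k) = if (k < m)%N then ip x (e k) else 0.
Proof.
elim: m => [|m IH]; first by rewrite /psum big_geq// (ip0l hip).
rewrite /psum big_nat_recr//= (ipDl hip) (ipZl hip) of_ IH ltnS.
by case: ltngtP => [_|_|->]; rewrite ?mulr0 ?addr0// mulr1 add0r.
Qed.

Lemma sqr_norm_real (c : C) : (complex.Re (`|c| ^+ 2))%:C%C = `|c| ^+ 2.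
Proof. by rewrite RRe_real// ger0_real// exprn_ge0. Qed.

Lemma rnorm_sqZ (c : C) x : rnorm x = 1 -> rnorm (c *: x) ^+ 2 = complex.Re (`|c| ^+ 2).
Proof.
move=> x1; apply: (@complexI R); rewrite sqr_norm_real rmorphXn /= -rnormE normrZ.
by rewrite rnormE x1 mulr1.
Qed.

Lemma orthonormal_rnorm g n : orthonormal g -> rnorm (g n) = 1.
Proof.
move=> /(_ n n); rewrite eqxx (ip_self hip) -(rmorph1 (real_complex R)) => /complexI/eqP.
by rewrite sqrf_eq1 => /orP[/eqP//|/eqP h]; have := rnorm_ge0 (g n); rewrite h ler0N1.
Qed.

Lemma psumB_sq x n m : (n <= m)%N -> rnorm (psum x m - psum x n) ^+ 2 = csum x m - csum x n.
Proof.
move=> /subnK <-; elim: (m - n)%N => [|k IH]; first by rewrite !subrr rnorm0 expr0n.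
rewrite addSn /psum /csum !big_nat_recr//= -/(psum _ _) -/(csum _ _).
rewrite addrAC (rnormD_orth hip).
  by rewrite IH rnorm_sqZ ?orthonormal_rnorm//; rewrite /csum addrAC.
rewrite (ipZr hip) (ipBl hip) !psum_ip ltnn ltnNge leq_addl /= subrr.
by rewrite mulr0.
Qed.

Lemma bessel x m : csum x m <= rnorm x ^+ 2.
Proof.
suff h : rnorm (x - \sum_(0 <= k < m) ip x (e k) *: e k) ^+ 2 = rnorm x ^+ 2 - csum x m.
  by rewrite -subr_ge0 -h sqr_ge0.
have hi k p : ip (\sum_(0 <= j < p) ip x (e j) *: e j) (e k) = if (k < p)%N then ip x (e k) else 0.
  elim: p => [|p IH]; first by rewrite big_geq// (ip0l hip).
  rewrite big_nat_recr//= (ipDl hip) (ipZl hip) oe IH ltnS.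
  by case: ltngtP => [_|_|->]; rewrite ?mulr0 ?addr0// mulr1 add0r.
elim: m => [|m IH]; first by rewrite /csum !big_geq// !subr0.
rewrite /csum !big_nat_recr// opprD addrA (rnormB_sq hip) IH -/(csum _ _).
rewrite rnorm_sqZ ?(orthonormal_rnorm _ oe)// /rip (ipZr hip) (ipBl hip) hi ltnn subr0.
by rewrite -normCKC; set c := complex.Re _; rewrite /=; ring.
Qed.

Lemma psum_le x m : rnorm (psum x m) <= rnorm x.
Proof.
rewrite -(@ler_pXn2r _ 2) ?nnegrE ?rnorm_ge0//; apply: le_trans (bessel x m).
have := psumB_sq x (leq0n m).
by rewrite /psum /csum (@big_geq _ _ _ 0 0)// subr0 (@big_geq _ _ _ 0 0)// subr0 => ->.
Qed.

Lemma psum_cvg x : exists l, forall d : R, 0 < d ->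
  exists n, forall m, (n <= m)%N -> rnorm (psum x m - l) < d.
Proof.
apply: cauchy_rnorm_cvg => d d0.
pose D := range (csum x); have supD : has_sup D.
  by split; [exists (csum x 0); exists 0%N|exists (rnorm x ^+ 2) => _ [m _ <-]; exact: bessel].
have d1 : 0 < d ^+ 2 / 4 by rewrite divr_gt0// exprn_gt0.
(* From this [n] on, [csum] stays within d^2 / 4 of its supremum, so [psum] moves by less than d /
   2. *)
have [_ [n _ <-] hn] := sup_adherent d1 supD.
have hc m : (n <= m)%N -> rnorm (psum x m - psum x n) < d / 2.
  move=> nm; rewrite -(@ltr_pXn2r _ 2) ?nnegrE ?rnorm_ge0 ?divr_ge0 ?ltW//.
  rewrite psumB_sq// expr_div_n.
  have : csum x m <= sup D by apply: ub_le_sup; [exact: supD.2|exists m].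
  by move: hn; rewrite (_ : 2 ^+ 2 = 4 :> R); [lra|rewrite -natrX].
exists n => m k nm nk.
have -> : psum x m - psum x k = (psum x m - psum x n) - (psum x k - psum x n).
  by rewrite opprB addrA subrK.
by apply: (le_lt_trans (rnormB _ _)); have := hc m nm; have := hc k nk; lra.
Qed.

(** [W x] is the limit of the partial sums. Its coefficients along [f] are linear in [x], and
    completeness of [f] in [B] turns this into linearity of [W]. *)
Lemma orthonormal_transfer B : closed_subspace B -> (forall n, B (f n)) ->
  (forall z, B z -> (forall n, ip z (f n) = 0) -> z = 0) ->
  exists W : H -> H, [/\ linear W, forall x, B (W x), forall x, rnorm (W x) <= rnorm x &
    forall x n, ip (W x) (f n) = ip x (e n)].
Proof.
move=> hB Bf fc; have /choice[W hW] := psum_cvg.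
have Bpsum x m : B (psum x m).
  apply: (big_ind B) => [|y z|i _]; first by case: hB.
    exact: closed_subspaceD.
  exact: closed_subspaceZ.
have BW x : B (W x).
  have [_ _ /closed_rnormP cB] := hB; apply: cB => d /(hW x)[n hn].
  by exists (psum x n) => //; exact: hn.
have Wf x k : ip (W x) (f k) = ip x (e k).
  apply/eqP; rewrite -subr_eq0; apply/eqP/(@ip_small_eq0 _ _ _ hip (f k)) => d d0.
  have [n hn] := hW x d d0; pose m := maxn n k.+1.
  exists (W x - psum x m); first by rewrite rnormBC hn// leq_maxl.
  by rewrite (ipBl hip) psum_ip leq_maxr.
have lW : linear W.
  move=> a x y; apply/eqP; rewrite -subr_eq0; apply/eqP/fc => [|n].
    apply: closed_subspaceB => //; apply: closed_subspaceD => //; exact: closed_subspaceZ.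
  by rewrite (ipBl hip) !(ipDl hip) !(ipZl hip) !Wf (ipDl hip) (ipZl hip) subrr.
exists W; split=> // x; apply/ler_addgt0Pr => d /(hW x)[n hn].
have -> : W x = psum x n - (psum x n - W x) by rewrite opprB addrC subrK.
apply: (le_trans (rnormB _ _)); apply: lerD; first exact: psum_le.
by apply/ltW/hn.
Qed.

End Transfer.

(** The transfers between a basis of [A] and one of [B], in both directions, are contractions and
    mutually inverse on the subspaces, since coefficients determine vectors. Hence |x| = |V (W x)|
    <= |W x| <= |x| on [A]. *)
Lemma isometric_subspaces A B : separable_space H ->
  closed_subspace A -> infinite_dim A -> closed_subspace B -> infinite_dim B ->
  exists W W' : H -> H, [/\ linear W, forall x, B (W x), forall x, rnorm (W x) <= rnorm x,
    forall x, A x -> rnorm (W x) = rnorm x & forall y, B y -> A (W' y) /\ W (W' y) = y].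
Proof.
move=> sH hA iA hB iB.
have [e [oe Ae ce]] := orthonormal_basis sH hA iA.
have [f [of_ Bf cf]] := orthonormal_basis sH hB iB.
have [W [lW BW Wle We]] := orthonormal_transfer oe of_ hB Bf cf.
have [V [lV AV Vle Ve]] := orthonormal_transfer of_ oe hA Ae ce.
have VW x : A x -> V (W x) = x.
  move=> Ax; apply/eqP; rewrite -subr_eq0; apply/eqP/ce; first exact: closed_subspaceB.
  by move=> n; rewrite (ipBl hip) Ve We subrr.
have WV y : B y -> W (V y) = y.
  move=> By; apply/eqP; rewrite -subr_eq0; apply/eqP/cf; first exact: closed_subspaceB.
  by move=> n; rewrite (ipBl hip) We Ve subrr.
exists W, V; split=> // [x Ax|y By]; last by split=> //; exact: WV.
by apply/eqP; rewrite eq_le Wle /= -{1}(VW x Ax) Vle.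
Qed.

End Orthonormal.

(** * Algebra of bounded linear maps, and complements obtained as kernels *)

Section Operators.
Variables (R : realType) (H : completeNormedModType R[i]).
Implicit Types (x y : H) (F G : H -> H).

Lemma linear_add F G : linear F -> linear G -> linear (fun x => F x + G x).
Proof. by move=> lF lG a x y; rewrite lF lG scalerDr addrACA. Qed.

Lemma linear_sub F G : linear F -> linear G -> linear (fun x => F x - G x).
Proof. by move=> lF lG a x y; rewrite lF lG scalerBr opprD addrACA. Qed.

Lemma linear_scale F (c : R[i]) : linear F -> linear (fun x => c *: F x).
Proof. by move=> lF a x y; rewrite lF scalerDr !scalerA mulrC. Qed.

Lemma linear_comp F G : linear F -> linear G -> linear (fun x => F (G x)).
Proof. by move=> lF lG a x y; rewrite lG lF. Qed.

Lemma rbounded_contraction F : (forall x, rnorm (F x) <= rnorm x) -> rbounded F.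
Proof. by move=> h; exists 1 => // x; rewrite mul1r. Qed.

Lemma rbounded_add F G : rbounded F -> rbounded G -> rbounded (fun x => F x + G x).
Proof.
move=> [M M0 hM] [K K0 hK]; exists (M + K) => [|x]; first exact: addr_ge0.
by apply: (le_trans (rnormD _ _)); rewrite mulrDl lerD.
Qed.

Lemma rbounded_sub F G : rbounded F -> rbounded G -> rbounded (fun x => F x - G x).
Proof.
move=> [M M0 hM] [K K0 hK]; exists (M + K) => [|x]; first exact: addr_ge0.
by apply: (le_trans (rnormB _ _)); rewrite mulrDl lerD.
Qed.

Lemma rbounded_scale F (c : R) : rbounded F -> rbounded (fun x => c%:C%C *: F x).
Proof.
move=> [M M0 hM]; exists (`|c| * M) => [|x]; first by rewrite mulr_ge0.
by rewrite rnormZ -mulrA ler_wpM2l.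
Qed.

Lemma rbounded_comp F G : rbounded F -> rbounded G -> rbounded (fun x => F (G x)).
Proof.
move=> [M M0 hM] [K K0 hK]; exists (M * K) => [|x]; first exact: mulr_ge0.
by apply: (le_trans (hM _)); rewrite -mulrA ler_wpM2l.
Qed.

Lemma bounded_below_inj A F (k : R) x : 0 < k ->
  (forall x, A x -> k * rnorm x <= rnorm (F x)) -> A x -> F x = 0 -> x = 0.
Proof.
move=> k0 hk Ax Fx; apply/rnorm_eq0/eqP; rewrite eq_le rnorm_ge0 andbT.
by have := hk x Ax; rewrite Fx rnorm0 pmulr_rle0.
Qed.

(** Along [S], h = F h + (h - F h); along [T], h = t + (h - t), where t is the vector of [T] with F
    t = F h. *)
Lemma common_complement_retraction (S T : set H) F : linear F -> rbounded F ->
  (forall x, S (F x)) -> (forall x, S x -> F x = x) ->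
  (forall x, T x -> F x = 0 -> x = 0) -> (forall y, S y -> exists2 x, T x & F x = y) ->
  common_complement S T.
Proof.
move=> lF bF SF FS injF surF; exists [set x | F x = 0]; split.
- exact: closed_subspace_ker.
- by move=> x [Sx /= Fx]; rewrite -(FS x Sx).
- by move=> x [Tx /= Fx]; apply: injF.
- move=> h; exists (F h), (h - F h); split=> //=; last by rewrite addrC subrK.
  by rewrite linearB_fun// (FS (F h))// subrr.
- move=> h; have [t Tt Ft] := surF _ (SF h); exists t, (h - t).
  by split=> //=; [rewrite linearB_fun// Ft subrr|rewrite addrC subrK].
Qed.

End Operators.

(** * A common complement for subspaces with gaps in both directions *)

Section CommonComplement.
Variables (R : realType) (H : completeNormedModType R[i]) (ip : H -> H -> R[i]).
Hypotheses (hip : inner_product ip) (sH : separable_space H).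
Implicit Types (x y z : H) (A B S T : set H) (E F P Q : H -> H).

(** The inverse of [F] on its image, preceded by the projection onto that image. Injectivity of [F]
    on [A] makes the chosen preimages linear, and the lower bound makes them bounded. *)
Lemma bounded_below_inverse A F E (k : R) : closed_subspace A -> linear F -> 0 < k ->
  (forall x, A x -> k * rnorm x <= rnorm (F x)) -> proj_onto ip E (F @` A) ->
  exists r, [/\ linear r, rbounded r, forall x, A (r x) & forall x, F (r x) = E x].
Proof.
move=> hA lF k0 hk hE; have [lE AE _] := hE.
have /choice[r hr] : forall x, exists y, A y /\ F y = E x.
  by move=> x; have [y Ay <-] := AE x; exists y.
exists r; split=> [a x y||x|x]; [| |exact: (hr x).1|exact: (hr x).2].
  apply/eqP; rewrite -subr_eq0; apply/eqP/(bounded_below_inj k0 hk).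
    apply: closed_subspaceB => //; first exact: (hr _).1.
    by case: hA => _ h _; apply: h; exact: (hr _).1.
  by rewrite linearB_fun// lF !(hr _).2 lE subrr.
exists k^-1 => [|x]; first by rewrite invr_ge0 ltW.
rewrite mulrC ler_pdivlMr// mulrC; apply: (le_trans (hk _ (hr x).1)).
rewrite (hr x).2 -(@ler_pXn2r _ 2) ?nnegrE ?rnorm_ge0// (proj_pythag hip hE x).
by rewrite lerDl sqr_ge0.
Qed.

Section Construction.
Variables (S T : set H) (P Q : H -> H).
Hypotheses (hS : closed_subspace S) (hP : proj_onto ip P S).
Hypotheses (hT : closed_subspace T) (hQ : proj_onto ip Q T).

(* For t in T the component of P t in S1 has norm at most sqrt (1 - tau^2) |t|, so it
   cannot cancel the vector (4 / tau) J (t - P t) unless t - P t is small; in that case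
   P t has a large component orthogonal to S1. *)
Lemma shifted_proj_bounded_below (S1 : set H) (J : H -> H) (tau : R) :
  closed_subspace S1 -> S1 `<=` S -> 0 < tau <= 1 ->
  (forall s, S1 s -> tau * rnorm s <= rnorm (s - Q s)) ->
  (forall x, S1 (J x)) -> (forall x, rnorm (J x) = rnorm x) ->
  forall t, T t -> tau / 2 * rnorm t <= rnorm (P t + (4 / tau)%:C%C *: J (t - P t)).
Proof.
move=> hS1 S1S /andP[tau0 tau1] hQ1 SJ nJ t Tt.
have [E hE] := proj_exists hip hS1; have [_ S1E _] := hE.
pose b := E (P t); pose a := P t - b; pose p := t - P t.
have S1b : S1 b by exact: S1E.
(* As b lies in S1 and so in S, and t in T, the square |b|^2 is the real part of (t, b) = (t, Q
   b). *)
have bb : rnorm b ^+ 2 <= rnorm t * rnorm (Q b).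
  rewrite (rnorm_sq hip) /rip (proj_ip hip hE)// (proj_ip hip hP); last exact: S1S.
  by rewrite -{1}(proj_id hip hT hQ Tt) (proj_sym hip hQ); exact: rip_le.
have Qb := proj_pythag hip hQ b.
have tE := proj_pythag hip hP t; have PtE := proj_pythag hip hE (P t).
(* [a] is orthogonal to [S1], which contains [b] and the values of [J]. *)
have UE : rnorm (P t + (4 / tau)%:C%C *: J p) ^+ 2 =
          rnorm a ^+ 2 + rnorm (b + (4 / tau)%:C%C *: J p) ^+ 2.
  rewrite -(rnormD_orth hip); first by rewrite addrA subrK.
  by apply: (proj_orthc hE); apply: closed_subspaceD => //; exact: closed_subspaceZ.
have Jb := rnormDB ((4 / tau)%:C%C *: J p) b.
rewrite rnormZ nJ ger0_norm ?divr_ge0 ?(ltW tau0)// (addrC _ b) in Jb.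
have := hQ1 b S1b; move: tE PtE Qb bb UE Jb; rewrite -/b -/a -/p.
move: (rnorm_ge0 t) (rnorm_ge0 p) (rnorm_ge0 a) (rnorm_ge0 b) (rnorm_ge0 (Q b)).
move: (rnorm_ge0 (P t + (4 / tau)%:C%C *: J p)) (rnorm_ge0 (b + (4 / tau)%:C%C *: J p)).
move: (rnorm (P t + _)) (rnorm (b + _)) (rnorm t) (rnorm p) (rnorm a) (rnorm b).
move: (rnorm (Q b)) (rnorm (b - Q b)) (rnorm (P t)) => q q' pt u v n np na nb.
move=> u0 v0 n0 np0 na0 nb0 q0 tE PtE Qb bb UE Jb hq'.
have sq_le (c c' : R) : 0 <= c -> c <= c' -> c ^+ 2 <= c' ^+ 2.
  by move=> c0 cc'; rewrite ler_pXn2r ?nnegrE// (le_trans c0).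
have tau2 : tau ^+ 2 <= 1 by have := sq_le _ _ (ltW tau0) tau1; rewrite expr1n.
have qq : q ^+ 2 <= (1 - tau ^+ 2) * nb ^+ 2.
  by have := sq_le _ _ (mulr_ge0 (ltW tau0) nb0) hq'; rewrite exprMn; lra.
have nbn : nb ^+ 2 <= (1 - tau ^+ 2) * n ^+ 2.
  have [->|nb1] := eqVneq nb 0.
    by rewrite expr0n /= mulr_ge0 ?sqr_ge0// subr_ge0.
  have nb2 : 0 < nb ^+ 2 by rewrite exprn_gt0// lt_def nb1.
  rewrite -(ler_pM2l nb2) -[leLHS]expr2.
  apply: (le_trans (sq_le _ _ (sqr_ge0 _) bb)); rewrite exprMn.
  have -> : nb ^+ 2 * ((1 - tau ^+ 2) * n ^+ 2) = n ^+ 2 * ((1 - tau ^+ 2) * nb ^+ 2) by ring.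
  by rewrite ler_wpM2l ?sqr_ge0.
rewrite -(@ler_pXn2r _ 2) ?nnegrE ?mulr_ge0 ?divr_ge0 ?(ltW tau0)//.
have tn0 : 0 <= tau / 2 * n by rewrite mulr_ge0// divr_ge0// ltW.
(* Either [a] alone is large enough, or |t|^2 = |a|^2 + |b|^2 + |p|^2 makes [p] large. In the latter
   case (4 / tau) J p has norm at least 2 |t|, and subtracting [b], of norm at most |t|, leaves at
   least |t|. *)
have [an|an] := leP (tau / 2 * n) na.
  by have := sq_le _ _ tn0 an; have := sqr_ge0 v; lra.
have pn : tau / 2 * n <= np.
  rewrite -(@ler_pXn2r _ 2) ?nnegrE//.
  have := sq_le _ _ na0 (ltW an); have := sqr_ge0 (tau / 2 * n).
  have : tau ^+ 2 * n ^+ 2 = 4 * (tau / 2 * n) ^+ 2 by field.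
  move: (tau / 2 * n) => w; lra.
have pn2 : 2 * n <= 4 / tau * np.
  have h : 4 / tau * (tau / 2 * n) = 2 * n by field; rewrite gt_eqF.
  by rewrite -h ler_wpM2l// divr_ge0// ltW.
have nbn1 : nb <= n.
  rewrite -(@ler_pXn2r _ 2) ?nnegrE//; apply: (le_trans nbn).
  by rewrite ler_piMl ?sqr_ge0// gerBl sqr_ge0.
have nv : tau / 2 * n <= v.
  by apply: (@le_trans _ _ n); [rewrite ler_piMl//; lra|lra].
by have := sq_le _ _ tn0 nv; have := sqr_ge0 na; lra.
Qed.

Lemma common_complement_of_gaps (S1 T1 : set H) (sigma tau : R) :
  closed_subspace S1 -> S1 `<=` S -> infinite_dim S1 -> 0 < tau <= 1 ->
  (forall s, S1 s -> tau * rnorm s <= rnorm (s - Q s)) ->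
  closed_subspace T1 -> T1 `<=` T -> infinite_dim T1 -> 0 < sigma ->
  (forall t, T1 t -> sigma * rnorm t <= rnorm (t - P t)) ->
  common_complement S T.
Proof.
move=> hS1 S1S iS1 tau01 gS hT1 T1T iT1 sigma0 gT.
have [lP SP _] := hP; have lP' := proj_compl_linear hP.
have bP : rbounded P by apply: rbounded_contraction => x; exact: (proj_le hip hP).
have bP' : rbounded (fun x => x - P x).
  by apply: rbounded_contraction => x; exact: (proj_compl_le hip hP).
have iH : infinite_dim [set: H].
  by move=> n; have [v [_ hv]] := iS1 n; exists v.
have [J [J' [lJ SJ Jle nJ _]]] := isometric_subspaces hip sH (closed_subspaceT H) iH hS1 iS1.
have bJ := rbounded_contraction Jle.
pose U x := P x + (4 / tau)%:C%C *: J (x - P x).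
have lU : linear U by apply: linear_add lP (linear_scale _ (linear_comp lJ lP')).
have bU : rbounded U by apply: rbounded_add bP (rbounded_scale _ (rbounded_comp bJ bP')).
have SU x : S (U x).
  by apply: closed_subspaceD (SP x) _ => //; apply: closed_subspaceZ => //; exact: S1S.
have tau2 : 0 < tau / 2 by case/andP: tau01 => tau0 _; rewrite divr_gt0.
have Ubelow t : T t -> tau / 2 * rnorm t <= rnorm (U t).
  move=> Tt; apply: (shifted_proj_bounded_below hS1 S1S tau01 gS SJ) => // x.
  exact: nJ.
have Uinj t : T t -> U t = 0 -> t = 0 by exact: (bounded_below_inj tau2 Ubelow).
pose G := (fun x => x - P x) @` T1.
have hG : closed_subspace G by exact: closed_subspace_image gT.
have [E hE] := proj_exists hip hG; have [lE GE _] := hE.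
have bE : rbounded E by apply: rbounded_contraction => x; exact: (proj_le hip hE).
(* [r] recovers a vector of [T1] from the component in [G]. It vanishes on [S] and fixes [T1]; on
   [T] it is the oblique projection onto [T1] along the [T0] defined below. *)
have [r [lr br T1r rE]] := bounded_below_inverse hT1 lP' sigma0 gT hE.
have ES s : S s -> E s = 0.
  move=> Ss; apply: (proj_orth0 hip hG hE) => _ [t _ <-].
  by apply: (ip_eq0C hip); exact: (proj_orthc hP).
have ET1 t : T1 t -> E t = t - P t.
  move=> T1t; rewrite -{1}(subrK (P t) t) linearD_fun// (ES (P t))// addr0.
  by apply: (proj_id hip hG hE); exists t.
have rS s : S s -> r s = 0.
  move=> Ss; apply: (bounded_below_inj sigma0 gT) => //=.
  by rewrite (rE s) ES.
have rT1 t : T1 t -> r t = t.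
  move=> T1t; apply/eqP; rewrite -subr_eq0; apply/eqP/(bounded_below_inj sigma0 gT).
    exact: closed_subspaceB.
  by rewrite /= (linearB_fun _ _ lP') (rE t) ET1// subrr.
pose T0 := T `&` [set t | E t = 0].
have hT0 : closed_subspace T0 by apply: closed_subspaceI => //; exact: closed_subspace_ker.
have T0r t : T t -> T0 (t - r t).
  move=> Tt; split=> /=; first by apply: closed_subspaceB => //; exact: T1T.
  by rewrite linearB_fun// (ET1 (r t))// rE subrr.
pose F0 := U @` T0.
have hF0 : closed_subspace F0.
  by apply: (closed_subspace_image hT0 lU bU tau2) => t [Tt _]; exact: Ubelow.
have F0S : F0 `<=` S by move=> _ [t _ <-].
have [D hD] := proj_exists hip hF0; have [lD FD _] := hD.
pose K := S `&` orthc ip F0.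
have hK : closed_subspace K by apply: closed_subspaceI => //; exact: closed_subspace_orthc.
(* The map (1 - D) U is injective on [T1]: if U t lies in U T0, then t lies in T0, where [r]
   vanishes, while r t = t. *)
have iK : infinite_dim K.
  apply: (infinite_dim_image (F := fun x => U x - D (U x)) hT1) iT1.
  - by apply: linear_sub => //; exact: linear_comp.
  - move=> x _; split; last exact: (proj_orthc hD).
    by apply: closed_subspaceB => //; exact: F0S.
  move=> t T1t /eqP; rewrite subr_eq0 => /eqP UD.
  have [t0 [Tt0 /= Et0]] := FD (U t); rewrite -UD => Ut.
  have tt0 : t - t0 = 0.
    apply: Uinj; first by apply: closed_subspaceB => //; exact: T1T.
    by rewrite linearB_fun// Ut subrr.
  have tE : t = t0 by apply/eqP; rewrite -subr_eq0 tt0.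
  by rewrite -(rT1 t T1t); apply: (bounded_below_inj sigma0 gT) => //=; rewrite rE tE.
have [W [W' [lW KW Wle nW WW']]] := isometric_subspaces hip sH hT1 iT1 hK iK.
have bW := rbounded_contraction Wle.
(* This is the map F of the overview: on [S] the terms after [P x] vanish; on [T0] both [E] and [r]
   vanish, leaving [U]; on [T1] the argument of [J] vanishes and [P] cancels, leaving [W]. *)
pose B x := P x + (4 / tau)%:C%C *: J (x - P x - E x) + (W (r x) - P (r x)).
have lB : linear B.
  apply: linear_add; last by apply: linear_sub; exact: linear_comp.
  by apply: linear_add => //; apply/linear_scale/linear_comp => //; exact: linear_sub.
have bB : rbounded B.
  apply: rbounded_add; last by apply: rbounded_sub; exact: rbounded_comp.
  apply: rbounded_add => //; apply: rbounded_scale; apply: rbounded_comp => //.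
  exact: rbounded_sub.
have BT0 t : T0 t -> B t = U t.
  move=> [Tt /= Et]; rewrite /B /U Et subr0.
  have -> : r t = 0 by apply: (bounded_below_inj sigma0 gT) => //=; rewrite rE.
  by rewrite (linear0 lW) (linear0 lP) subrr addr0.
have BT1 t : T1 t -> B t = W t.
  move=> T1t; rewrite /B rT1// ET1// subrr (linear0 lJ) scaler0 addr0.
  by rewrite addrC subrK.
have BT t : T t -> B t = U (t - r t) + W (r t).
  move=> Tt; rewrite -{1}(subrK (r t) t) (linearD_fun _ _ lB) BT0; last exact: T0r.
  by rewrite BT1.
apply: (common_complement_retraction lB bB).
- move=> x; apply: closed_subspaceD => //; last first.
    by apply: closed_subspaceB => //; case: (KW (r x)).
  by apply: closed_subspaceD => //; apply: closed_subspaceZ => //; exact: S1S.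
- move=> s Ss; rewrite /B (proj_id hip hS hP Ss) subrr ES// subr0 rS//.
  by rewrite (linear0 lJ) scaler0 (linear0 lW) (linear0 lP) subrr !addr0.
- move=> t Tt; rewrite BT// => h.
  (* The two summands of [B t] lie in [F0] and in its orthogonal complement, so both vanish when
     [B t] does. *)
  have o : ip (U (t - r t)) (W (r t)) = 0.
    apply: (ip_eq0C hip); case: (KW (r t)) => _; apply; exists (t - r t) => //; exact: T0r.
  have := rnormD_orth hip o; rewrite h rnorm0 expr0n /= => /esym/eqP.
  rewrite paddr_eq0 ?sqr_ge0// !sqrf_eq0 => /andP[/eqP/rnorm_eq0 U0 /eqP].
  rewrite nW// => /rnorm_eq0 rt0.
  by move: U0; rewrite rt0 subr0; exact: Uinj.
(* Split s into D s, reached from [T0] by [U], and s - D s in [K], reached from [T1] by [W]. *)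
- move=> s Ss; have [t0 T0t0 Ut0] := FD s.
  have Ks : K (s - D s).
    split; last exact: (proj_orthc hD).
    by apply: closed_subspaceB => //; exact: F0S.
  have [T1w Ww] := WW' _ Ks; exists (t0 + W' (s - D s)).
    by apply: closed_subspaceD => //; [case: T0t0|exact: T1T].
  by rewrite (linearD_fun _ _ lB) BT0// BT1// Ww Ut0 addrC subrK.
Qed.

End Construction.
End CommonComplement.

(** * Small perturbations of subspaces that open a gap *)

Section Perturbation.
Variables (R : realType) (H : completeNormedModType R[i]) (ip : H -> H -> R[i]).
Hypotheses (hip : inner_product ip) (sH : separable_space H).
Implicit Types (x y z : H) (A B S T : set H) (E F P Q : H -> H).

(** The even terms of a greedy orthonormal sequence lie in [A] and the odd ones in [B]. Defining [X]
    and [Y] by orthogonality conditions, rather than as closed spans, makes them closed at once. *)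
Lemma infinite_dim_orthogonal_pair A B : closed_subspace A -> infinite_dim A ->
  closed_subspace B -> infinite_dim B ->
  exists X Y, [/\ closed_subspace X, X `<=` A & infinite_dim X] /\
    [/\ closed_subspace Y, Y `<=` B, infinite_dim Y & forall x y, X x -> Y y -> ip x y = 0].
Proof.
move=> hA iA hB iB.
have [l|e oe he] := @orthonormal_dependent_seq _ _ _ hip
    (fun l x => if odd (size l) then B x else A x).
  by case: odd; exact: infinite_dim_orth_unit.
have Ae n : A (e n.*2) by have := he n.*2; rewrite size_mkseq odd_double.
have Be n : B (e n.*2.+1) by have := he n.*2.+1; rewrite size_mkseq /= odd_double.
have oe' k (p : nat -> nat) : (forall n, p n = n.*2 + k)%N -> orthonormal ip (e \o p).
  move=> hp n m; rewrite /= oe !hp eqn_add2r.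
  by rewrite -!muln2 eqn_mul2r.
pose X := A `&` orthc ip [set e n.*2.+1 | n in setT]; pose Y := B `&` orthc ip X.
have Xe n : X (e n.*2).
  split=> // _ [m _ <-]; rewrite oe; case: eqP => // h.
  by have := congr1 odd h; rewrite /= !odd_double.
have Ye n : Y (e n.*2.+1).
  by split=> // x [_]; move=> hx; apply: (ip_eq0C hip); apply: hx; exists n.
exists X, Y; split; split.
- by apply: closed_subspaceI => //; exact: closed_subspace_orthc.
- by move=> x [].
- apply: (orthonormal_infinite_dim hip (e := e \o double)) => [|n]; last exact: Xe.
  by apply: (oe' 0%N) => n; rewrite addn0.
- by apply: closed_subspaceI => //; exact: closed_subspace_orthc.
- by move=> y [].
- apply: (orthonormal_infinite_dim hip (e := e \o (S \o double))) => [|n]; last exact: Ye.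
  by apply: (oe' 1%N) => n; rewrite addn1.
- by move=> x y Xx [_ Yy]; apply: (ip_eq0C hip); exact: Yy.
Qed.

(** Write Q - Q' = (Q - Q' Q) - Q' (1 - Q). The first term is at most th because Q x is that close
    to F (Q x). For the second, if Q' (x - Q x) = F t, then its squared norm is the real part of (x
    - Q x, F t - t), and |t| <= 2 |F t| gives 2 th. *)
Lemma proj_near_image T Q F Q' (th : R) : closed_subspace T -> proj_onto ip Q T ->
  (forall x, rnorm (F x - x) <= th * rnorm x) -> 0 <= th ->
  (forall x, rnorm x <= 2 * rnorm (F x)) ->
  closed_subspace (F @` T) -> proj_onto ip Q' (F @` T) ->
  forall x, rnorm (Q x - Q' x) <= 3 * th * rnorm x.
Proof.
move=> hT hQ Fth th0 Fbelow hFT hQ' x.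
have [lQ TQ _] := hQ; have [lQ' _ _] := hQ'.
have h1 : rnorm (Q x - Q' (Q x)) <= th * rnorm x.
  apply: (@le_trans _ _ (rnorm (Q x - F (Q x)))).
    by apply: (proj_dist hip hFT hQ'); exists (Q x).
  rewrite rnormBC; apply: (le_trans (Fth _)); rewrite ler_wpM2l//.
  exact: (proj_le hip hQ).
have h2 : rnorm (Q' (x - Q x)) <= 2 * th * rnorm x.
  have [_ /(_ (x - Q x))[t Tt tE] _] := hQ'.
  have w2 : rnorm (Q' (x - Q x)) ^+ 2 = rip ip (x - Q x) (F t - t).
    rewrite (rnorm_sq hip) /rip (proj_ip hip hQ'); last by case: hQ'.
    by rewrite -tE (ipBr hip) (proj_orthc hQ x Tt) subr0.
  have := rip_le hip (x - Q x) (F t - t); have := proj_compl_le hip hQ x.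
  have := Fth t; have := Fbelow t; rewrite -w2 {1}tE; have := rnorm_ge0 (Q' (x - Q x)).
  move: (rnorm (Q' _)) (rnorm (F t - t)) (rnorm_ge0 (F t - t)) (rnorm_ge0 x) (rnorm_ge0 (x - Q x)).
  move: (rnorm (x - Q x)) (rnorm x) (rnorm t) => v n k w d d0 n0 v0 w0 kw dk vn wd.
  have [->|w1] := eqVneq w 0; first by rewrite !mulr_ge0.
  have {}w1 : 0 < w by rewrite lt_def w1.
  rewrite -(ler_pM2l w1) -expr2; apply: (le_trans wd).
  have -> : w * (2 * th * n) = n * (th * (2 * w)) by ring.
  apply: ler_pM => //; apply: (le_trans dk); exact: ler_wpM2l.
have -> : Q x - Q' x = (Q x - Q' (Q x)) - Q' (x - Q x).
  by rewrite (linearB_fun _ _ lQ') opprB addrA subrK.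
by apply: (le_trans (rnormB _ _)); lra.
Qed.

(** For x in X, the vector K x is orthogonal to S and to x - P x, so (1 - P) (x + th K x) has norm
    at least th |x|; as |x + th K x| <= 2 |x|, the gap is th / 2. *)
Lemma perturbation S T P Q (e : R) : closed_subspace S -> proj_onto ip P S ->
  closed_subspace T -> proj_onto ip Q T ->
  infinite_dim T -> infinite_dim (orthc ip S) -> 0 < e ->
  exists T' Q' T1 (s : R),
    [/\ closed_subspace T', proj_onto ip Q' T' &
        forall x, rnorm (Q x - Q' x) <= e * rnorm x] /\
    [/\ closed_subspace T1, T1 `<=` T', infinite_dim T1, 0 < s <= 1 &
        forall t, T1 t -> s * rnorm t <= rnorm (t - P t)].
Proof.
move=> hS hP hT hQ iT iS e0.
have [X [Y [[hX XT iX] [hY YS iY XY]]]] :=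
  infinite_dim_orthogonal_pair hT iT (closed_subspace_orthc hip S) iS.
have [K [K' [lK YK Kle nK _]]] := isometric_subspaces hip sH hX iX hY iY.
(* The bound e / 3 absorbs the factor 3 in the distance between the projections; 1 / 2 makes [F]
   bounded below by 1 / 2. *)
pose th := Num.min (e / 3) (1 / 2).
have th0 : 0 < th by rewrite lt_min !divr_gt0.
have th1 : th <= 1 / 2 by rewrite ge_min lexx orbT.
have the : 3 * th <= e.
  have : th <= e / 3 by rewrite ge_min lexx.
  by rewrite ler_pdivlMr// mulrC.
pose F x := x + th%:C%C *: K x.
have lF : linear F by apply: linear_add => //; exact: linear_scale.
have bF : rbounded F.
  apply: rbounded_add; first exact: rbounded_contraction.
  by apply/rbounded_scale/rbounded_contraction.
have Fth x : rnorm (F x - x) <= th * rnorm x.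
  by rewrite /F addrC addKr rnormZ gtr0_norm// ler_wpM2l// ltW.
have Fbelow x : rnorm x <= 2 * rnorm (F x).
  have := rnormDB x (F x - x); rewrite (addrC x) subrK; have := Fth x.
  have := rnorm_ge0 x; nra.
have hFA A : closed_subspace A -> closed_subspace (F @` A).
  move=> hA; apply: (@closed_subspace_image _ _ _ _ 2^-1) => // x _.
  by rewrite mulrC ler_pdivrMr// mulrC.
have [Q' hQ'] := proj_exists hip (hFA _ hT).
have [lP _ _] := hP.
exists (F @` T), Q', (F @` X), (th / 2); split; split=> //; [exact: hFA| |exact: hFA| | | |].
- move=> x; apply: (@le_trans _ _ (3 * th * rnorm x)).
    exact: (proj_near_image hT hQ Fth (ltW th0) Fbelow (hFA _ hT) hQ').
  by rewrite ler_wpM2r// rnorm_ge0.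
- by move=> _ [x Xx <-]; exists x => //; exact: XT.
- apply: (infinite_dim_image hX lF) iX => [x Xx|x _ Fx]; first by exists x.
  by apply/rnorm_eq0/eqP; rewrite eq_le rnorm_ge0 andbT; have := Fbelow x; rewrite Fx rnorm0 mulr0.
- by apply/andP; split; [rewrite divr_gt0|lra].
move=> _ [x Xx <-].
have KS : orthc ip S (K x) by exact: YS.
have -> : F x - P (F x) = (x - P x) + th%:C%C *: K x.
  rewrite /F (linearD_fun _ _ lP) (linearZ_fun _ _ lP) (proj_orth0 hip hS hP KS) scaler0 addr0.
  by rewrite addrAC.
have o : ip (x - P x) (th%:C%C *: K x) = 0.
  rewrite (ipZr hip) (ipBl hip) XY// (ip_eq0C hip) ?subrr ?mulr0//.
  by apply: KS; case: hP.
have := rnormD_orth hip o; rewrite rnormZ gtr0_norm// nK// => n2.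
have : th * rnorm x <= rnorm (x - P x + th%:C%C *: K x).
  rewrite -(@ler_pXn2r _ 2) ?nnegrE ?rnorm_ge0 ?mulr_ge0 ?rnorm_ge0 ?(ltW th0)//.
  by rewrite n2 lerDr sqr_ge0.
apply: le_trans; rewrite -mulrA ler_pM2l//.
have := rnormD x (F x - x); rewrite (addrC x) subrK; have := Fth x; have := rnorm_ge0 x; nra.
Qed.

(** At distance less than 1, [Q'] is injective on [T], and 1 - Q' on the orthogonal complement of
    [T]. *)
Lemma infinite_dim_near T T' Q Q' (e : R) :
  closed_subspace T -> proj_onto ip Q T -> closed_subspace T' -> proj_onto ip Q' T' ->
  (forall x, rnorm (Q x - Q' x) <= e * rnorm x) -> e < 1 ->
  (infinite_dim T -> infinite_dim T') /\
  (infinite_dim (orthc ip T) -> infinite_dim (orthc ip T')).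
Proof.
move=> hT hQ hT' hQ' QQ' e1; have [lQ' TQ' _] := hQ'.
have small x : rnorm x <= e * rnorm x -> x = 0.
  move=> h; apply/rnorm_eq0/eqP; rewrite eq_le rnorm_ge0 andbT.
  by have := rnorm_ge0 x; nra.
split; [apply: (infinite_dim_image hT lQ')|
        apply: (infinite_dim_image (closed_subspace_orthc hip T) (proj_compl_linear hQ'))].
- by move=> x _; exact: TQ'.
- move=> x Tx Qx; apply: small.
  by have := QQ' x; rewrite Qx subr0 (proj_id hip hT hQ Tx).
- by move=> x _; exact: (proj_orthc hQ').
- move=> x Tx /eqP; rewrite subr_eq0 => /eqP Qx; apply: small.
  by have := QQ' x; rewrite -Qx (proj_orth0 hip hT hQ Tx) sub0r rnormN.
Qed.

End Perturbation.

(** * Density, by two successive perturbations *)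

Theorem mainTheorem4 (R : realType) (H : completeNormedModType R[i])
    (ip : H -> H -> R[i]) :
  inner_product ip -> separable_space H -> infinite_dim [set: H] ->
  forall P Q : H -> H, proj_inf_inf ip P -> proj_inf_inf ip Q ->
  forall e : R[i], 0 < e ->
  exists P' Q' : H -> H,
    [/\ proj_inf_inf ip P', proj_inf_inf ip Q', in_Delta ip P' Q',
        opnorm_lt (fun x => P x - P' x) e
      & opnorm_lt (fun x => Q x - Q' x) e].
Proof.
move=> hip sH _ P Q [oP iP jP] [oQ iQ jQ] _ /gt0_complex[e e0 ->].
have [hS hP] := orth_proj_onto hip oP; have [hT hQ] := orth_proj_onto hip oQ.
rewrite (proj_nullspace hip hS hP) in jP; rewrite (proj_nullspace hip hT hQ) in jQ.
(* Below e for the required distance, and below 1 so that infinite rank and corank are preserved. *)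
pose e1 := Num.min (e / 2) (1 / 2).
have e10 : 0 < e1 by rewrite lt_min !divr_gt0.
have e1e : e1 < e by rewrite gt_min; apply/orP; left; lra.
have e11 : e1 < 1 by rewrite gt_min; apply/orP; right; lra.
have [T' [Q' [T1 [s [[hT' hQ' QQ'] [hT1 T1T' iT1 /andP[s0 s1] gT]]]]]] :=
  perturbation hip sH hS hP hT hQ iQ jP e10.
have [/(_ iQ) iT' /(_ jQ) jT'] := infinite_dim_near hip hT hQ hT' hQ' QQ' e11.
(* Moving [P] by at most s / 2 leaves [T1] a gap of s / 2 relative to the new projection [P']. *)
pose e2 := Num.min e1 (s / 2).
have e20 : 0 < e2 by rewrite lt_min e10 divr_gt0.
have e2e1 : e2 <= e1 by rewrite ge_min lexx.
have e2s : e2 <= s / 2 by rewrite ge_min lexx orbT.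
(* The roles are exchanged: [S] is perturbed relative to the already perturbed [T'], which stays
   fixed from here on. *)
have [S' [P' [S1 [t [[hS' hP' PP'] [hS1 S1S' iS1 t01 gS]]]]]] :=
  perturbation hip sH hT' hQ' hS hP iP jT' e20.
have [/(_ iP) iS' /(_ jP) jS'] := infinite_dim_near hip hS hP hS' hP' PP' (le_lt_trans e2e1 e11).
have ccl : common_complement S' T'.
  apply: (@common_complement_of_gaps _ _ _ hip sH _ _ _ _ hS' hP' hT' hQ' S1 T1 (s / 2) t) => //.
    by rewrite divr_gt0.
  move=> x T1x.
  have -> : x - P' x = (x - P x) + (P x - P' x) by rewrite addrA subrK.
  have := rnormDB (x - P x) (P x - P' x); have := gT x T1x; have := PP' x.
  have := rnorm_ge0 x; nra.
have op (F : H -> H) (d : R) : d < e -> (forall x, rnorm (F x) <= d * rnorm x) ->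
    opnorm_lt F e%:C%C.
  move=> de h; exists d%:C%C; split; first by rewrite ltcR.
  by move=> x; rewrite !rnormE -rmorphM /= lecR.
have inf_inf U E : closed_subspace U -> proj_onto ip E U -> infinite_dim U ->
    infinite_dim (orthc ip U) -> proj_inf_inf ip E.
  move=> hU hE iU jU; split; first exact: (proj_onto_orth_proj hip hU hE).
    by rewrite (proj_range hip hU hE).
  by rewrite (proj_nullspace hip hU hE).
exists P', Q'; split; [exact: inf_inf hP' _ _|exact: inf_inf hQ' _ _| | |].
- split; [exact: (proj_onto_orth_proj hip hS' hP')|exact: (proj_onto_orth_proj hip hT' hQ')|].
  by rewrite (proj_range hip hS' hP') (proj_range hip hT' hQ').
- exact: op (le_lt_trans e2e1 e1e) PP'.
- exact: op e1e QQ'.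
Qed.
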